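(* Let $T\ge1$, $n\ge2$, $\tau\in\{1,\dots,T\}$, $z^*\in\mathbb{R}$, and for $t=1,\dots,T$ let $\mu_t\in\mathbb{R}$, $\sigma_t>0$. Under $\mathbf{H_0}$ the real numbers $X_{t,k}$ ($t\le T$, $k\le n$) are independent with $X_{t,k}\sim\mathcal{N}(\mu_t,\sigma_t^2)$; under $\mathbf{H_1^\tau}$ they are generated the same way and then $X_{\tau,J}$ is replaced by $z^*$, with $J$ uniform on $\{1,\dots,n\}$ independent of the data. Let $\hat\mu_t=\frac{1}{nt}\sum_{j=1}^t\sum_{k=1}^nX_{j,k}$ ($\hat\mu_0:=0$). Then the ratio of the joint density of $(\hat\mu_1,\dots,\hat\mu_T)$ under $\mathbf{H_1^\tau}$ to that under $\mathbf{H_0}$ equals $\varphi(\hat\mu_\tau;m_1,v_1)/\varphi(\hat\mu_\tau;m_0,v_0)$, where $\varphi(\cdot;m,v)$ is the $\mathcal{N}(m,v)$ density and \[ m_0=\tfrac{\tau-1}{\tau}\hat\mu_{\tau-1}+\tfrac{\mu_\tau}{\tau},\quad v_0=\tfrac{\sigma_\tau^2}{\tau^2n},\quad m_1=\tfrac{\tau-1}{\tau}\hat\mu_{\tau-1}+\tfrac{(n-1)\mu_\tau+z^*}{\tau n},\quad v_1=\tfrac{(n-1)\sigma_\tau^2}{\tau^2n^2}. \] In particular, the likelihood ratio test of $\mathbf{H_0}$ against $\mathbf{H_1^\tau}$ depends on the distribution parameters only through $(\mu_\tau,\sigma_\tau^2)$, not on $(\mu_t,\sigma_t^2)$ for $t\neq\tau$.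 *)

(* Defs.v *)
From HB Require Import structures.
From mathcomp Require Import all_boot all_order all_algebra.
From mathcomp Require Import all_classical all_reals all_analysis.
Set Implicit Arguments. Unset Strict Implicit. Unset Printing Implicit Defensive.
Import Order.TTheory GRing.Theory Num.Theory.
Local Open Scope classical_set_scope.
Local Open Scope ring_scope.

(* N(m, v) density (v = variance), via the library's normal_pdf (which takes
   the standard deviation). *)
Definition phi {R : realType} (m v x : R) : R := normal_pdf m (Num.sqrt v) x.

(* Data x : 'I_T -> 'I_n -> R, with index t : 'I_T standing for time t+1
   and k : 'I_n standing for sample k+1.
   muhat x = (muhat_1, ..., muhat_T) where
   muhat_(i+1) = 1/(n (i+1)) * sum_{j <= i} sum_k x j k. *)
Definition muhat {R : realType} (T n : nat) (x : 'I_T -> 'I_n -> R) : T.-tuple R :=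
  [tuple (\sum_(j < T | (j <= i)%N) \sum_(k < n) x j k) / ((n * i.+1)%:R) | i < T].

(* muhat_{tau-1} with muhat_0 := 0; tau is the index 'I_T (time tau+1). *)
Definition muhat_prev {R : realType} (T : nat) (y : T.-tuple R) (tau : 'I_T) : R :=
  match tau with
  | Ordinal 0 _ => 0
  | Ordinal i.+1 Hi => tnth y (Ordinal (ltnW Hi))
  end.

Definition indep_data_J {R : realType} d (Omega : measurableType d)
    (P : probability Omega R) (T n : nat)
    (X : 'I_T -> 'I_n -> Omega -> R) (J : Omega -> 'I_n) : Prop :=
  (forall (B : 'I_T -> 'I_n -> set R), (forall t k, measurable (B t k)) ->
     P (\bigcap_(tk in [set: 'I_T * 'I_n]) (X tk.1 tk.2 @^-1` B tk.1 tk.2))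
     = \prod_(tk : 'I_T * 'I_n) P (X tk.1 tk.2 @^-1` B tk.1 tk.2))%E /\
  (forall (B : 'I_T -> 'I_n -> set R) (C : set 'I_n),
     (forall t k, measurable (B t k)) ->
     P ((\bigcap_(tk in [set: 'I_T * 'I_n]) (X tk.1 tk.2 @^-1` B tk.1 tk.2))
          `&` (J @^-1` C))
     = P (\bigcap_(tk in [set: 'I_T * 'I_n]) (X tk.1 tk.2 @^-1` B tk.1 tk.2))
       * P (J @^-1` C))%E.

(* Main.v *)
(** The means are a function of the row sum of row [tau] and of the other rows,
    and these two are independent.  Under both hypotheses the other rows have the
    same law, while the sum of row [tau] is normal: N(n mu, n sigma^2) under H0,
    and [zstar] plus N((n-1) mu, (n-1) sigma^2) under H1, whichever entry is
    replaced.  By Tonelli the likelihood ratio of the whole vector is therefore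
    the ratio of these two normal densities at the row sum, and the affine map
    from the row sum to muhat_tau (given muhat_(tau-1)) multiplies both densities
    by the same Jacobian. *)
Require Import Defs.
From HB Require Import structures.
From mathcomp Require Import all_boot all_order all_algebra.
From mathcomp Require Import all_classical all_reals all_analysis.
From mathcomp Require Import measurable_realfun ring lra.
Set Implicit Arguments. Unset Strict Implicit. Unset Printing Implicit Defensive.
Import Order.TTheory GRing.Theory Num.Theory.
Local Open Scope classical_set_scope.
Local Open Scope ring_scope.

(** * Normal laws on the line: densities, translation and convolution *)

Section NormalLaw.

Context {R : realType}.
Local Notation leb := (@lebesgue_measure R).

Lemma measurable_normal_pdfE (m s : R) :
  measurable_fun [set: R] (EFin \o normal_pdf m s).
Proof. by apply/measurable_EFinP; exact: measurable_normal_pdf. Qed.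

(** The Radon-Nikodym derivative of [normal_prob m s] and [normal_pdf m s] have the same integral
    over every measurable set, hence agree almost everywhere. *)
Lemma ge0_integral_normal_prob (m s : R) (f : R -> \bar R) :
  measurable_fun setT f -> (forall x, 0 <= f x)%E ->
  (\int[normal_prob m s]_x f x = \int[leb]_x (f x * (normal_pdf m s x)%:E))%E.
Proof.
move=> mf f0.
have dom := @normal_prob_dominates R m s.
rewrite -(Radon_Nikodym_SigmaFinite.change_of_variables dom)//.
apply: ae_eq_integral => //.
- apply: emeasurable_funM => //; apply: (measurable_int leb).
  exact: Radon_Nikodym_SigmaFinite.f_integrable.
- by apply: emeasurable_funM => //; exact: measurable_normal_pdfE.
- apply: ae_eqe_mul2l => /=; apply: integral_ae_eq => //=.
  + exact: Radon_Nikodym_SigmaFinite.f_integrable.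
  + exact: measurable_normal_pdfE.
  + by move=> E _ mE; rewrite -Radon_Nikodym_SigmaFinite.f_integral.
Qed.

(** The pushforward under a translation gives half-open intervals their length, and Lebesgue measure
    is the only measure that does. *)
Lemma lebesgue_measure_shift (c : R) (A : set R) : measurable A ->
  leb [set x | A (x + c)] = leb A.
Proof.
pose h := (fun x => x + c) : measurableTypeR R -> measurableTypeR R.
rewrite -[LHS]/(pushforward leb h A) => mA.
apply/esym/lebesgue_measure_unique => //=; first exact: measurable_funD.
move=> _ _ [[a b]] _ <-; rewrite /pushforward.
have -> : h @^-1` `]a, b]%classic = `]a - c, b - c]%classic.
  apply/seteqP; split => x; rewrite /h /= !in_itv/= => /andP[? ?];
    by apply/andP; split; lra.
rewrite !lebesgue_measure_itv/= !lte_fin ltrD2r; case: ifP => // _.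
by rewrite -!EFinB; congr _%:E; lra.
Qed.

Lemma ge0_integral_shift (c : R) (f : R -> \bar R) :
  measurable_fun setT f -> (forall x, 0 <= f x)%E ->
  (\int[leb]_x f (x + c)%R = \int[leb]_x f x)%E.
Proof.
move=> mf f0.
pose h := (fun x => x + c) : measurableTypeR R -> measurableTypeR R.
have mh : measurable_fun setT h by exact: measurable_funD.
transitivity (\int[leb]_(x in h @^-1` setT) (f \o h) x)%E => //.
rewrite -(ge0_integral_pushforward mh)//.
by apply: eq_measure_integral => //= A mA _; exact: lebesgue_measure_shift.
Qed.

Lemma complete_square (S T w y : R) : 0 < S -> 0 < T ->
  (w - y) ^+ 2 / S + y ^+ 2 / T =
  w ^+ 2 / (S + T) + (y - T * w / (S + T)) ^+ 2 / (S * T / (S + T)).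
Proof.
move=> S0 T0; have ST0 : 0 < S + T by rewrite addr_gt0.
by field; rewrite !gt_eqF.
Qed.

(** For independent normal summands [z - x] and [x], the joint density factors into the marginal of
    the total [z] and the conditional density of [x] given [z]. The second factor is again normal,
    so [x] integrates out to 1. *)
Lemma normal_pdf_convE (a b s t x z : R) : 0 < s -> 0 < t ->
  normal_pdf a s (z - x) * normal_pdf b t x =
  normal_pdf (a + b) (Num.sqrt (s ^+ 2 + t ^+ 2)) z *
  normal_pdf ((t ^+ 2 * (z - a) + s ^+ 2 * b) / (s ^+ 2 + t ^+ 2))
    (s * t / Num.sqrt (s ^+ 2 + t ^+ 2)) x.
Proof.
move=> s0 t0; set q := Num.sqrt _.
have q2 : q ^+ 2 = s ^+ 2 + t ^+ 2 by rewrite sqr_sqrtr// addr_ge0// sqr_ge0.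
have st0 : 0 < s ^+ 2 + t ^+ 2 by rewrite addr_gt0// exprn_gt0.
have q0 : 0 < q by rewrite sqrtr_gt0.
have p0 := @pi_gt0 R.
have qq0 : 0 < s * t / q by rewrite divr_gt0// mulr_gt0.
rewrite !normal_pdfE ?gt_eqF//.
rewrite mulrACA [RHS]mulrACA; congr (_ * _).
  rewrite /normal_peak -!invfM; congr (_^-1).
  rewrite -!sqrtrM ?mulrn_wge0 ?mulr_ge0 ?ltW ?exprn_gt0//.
  by congr Num.sqrt; field; rewrite ?gt_eqF.
rewrite /normal_fun -!expRD; congr expR.
rewrite !mulNr -!opprD; congr (- _).
have half (u v : R) : u / (v *+ 2) = u / v / 2%:R.
  by rewrite -(mulr_natr v) [(v * _)^-1]invfM mulrA.
rewrite (half _ (s ^+ 2)) (half _ (t ^+ 2)) (half _ (q ^+ 2)).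
rewrite (half _ ((s * t / q) ^+ 2)).
rewrite -mulrDl -[RHS]mulrDl; congr (_ / _).
rewrite [(s * t / q) ^+ 2]exprMn exprVn q2 [(s * t) ^+ 2]exprMn.
(* Centring total and summand puts the exponent in the form of [complete_square], with
   [w = z - (a + b)] and [y = x - b]. *)
have -> : z - x - a = (z - (a + b)) - (x - b) by ring.
rewrite complete_square ?exprn_gt0//; congr (_ + _); congr (_ ^+ 2 / _).
by field; rewrite gt_eqF.
Qed.

Lemma normal_probE (m s : R) (A : set R) :
  normal_prob m s A = (\int[leb]_x (normal_pdf m s x * \1_A x)%:E)%E.
Proof.
rewrite /normal_prob integral_mkcond; apply: eq_integral => x _.
by rewrite epatch_indic/= EFinM.
Qed.

Lemma measurable_normal_pdf_shift (m s c : R) (A : set R) : measurable A ->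
  measurable_fun [set: R]
    (fun z : R => (normal_pdf m s (z - c) * \1_A z)%:E).
Proof.
move=> mA; apply/measurable_EFinP; apply: measurable_funM => //.
apply: (measurableT_comp (measurable_normal_pdf m s)).
exact: measurable_funB.
Qed.

(** Moving the shift from the set into the density leaves an integrand jointly measurable in [c] and
    [z], as Tonelli requires. *)
Lemma normal_prob_shift (m s c : R) (A : set R) : measurable A ->
  normal_prob m s [set x | A (x + c)] =
  (\int[leb]_z (normal_pdf m s (z - c) * \1_A z)%:E)%E.
Proof.
move=> mA; rewrite normal_probE.
rewrite -(@ge0_integral_shift c (fun z => (normal_pdf m s (z - c) * \1_A z)%:E)).
- by apply: eq_integral => x _; rewrite addrK.
- exact: measurable_normal_pdf_shift.
- by move=> x; rewrite lee_fin mulr_ge0// normal_pdf_ge0.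
Qed.

Lemma measurable_normal_pdf_section (m s : R) (A : set R) : measurable A ->
  measurable_fun [set: R * R]
    (fun p : R * R => (normal_pdf m s (p.2 - p.1) * \1_A p.2)%:E).
Proof.
move=> mA; apply/measurable_EFinP; apply: measurable_funM.
  apply: (measurableT_comp (measurable_normal_pdf m s)).
  exact: measurable_funB.
exact: measurableT_comp.
Qed.

Lemma measurable_normal_prob_shift (m s : R) (A : set R) : measurable A ->
  measurable_fun [set: R]
    (fun c : R => normal_prob m s [set x | A (x + c)]).
Proof.
move=> mA; under eq_fun do rewrite normal_prob_shift//.
have := @measurable_fun_fubini_tonelli_F _ _ _ _ R leb _
  (measurable_normal_pdf_section m s mA).
by apply=> p; rewrite lee_fin mulr_ge0// normal_pdf_ge0.
Qed.

(** After Tonelli the inner integral runs over the summand [x], where [normal_pdf_convE] leaves a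
    normal density of total mass 1. *)
Lemma normal_prob_conv (a b s t : R) (A : set R) : 0 < s -> 0 < t ->
  measurable A ->
  (\int[normal_prob b t]_x normal_prob a s [set w | A (w + x)%R] =
   normal_prob (a + b)%R (Num.sqrt (s ^+ 2 + t ^+ 2)) A)%E.
Proof.
move=> s0 t0 mA.
pose f (p : R * R) := (normal_pdf a s (p.2 - p.1) * \1_A p.2)%:E.
have mf : measurable_fun setT f by exact: measurable_normal_pdf_section.
have f0 p : (0 <= f p)%E by rewrite lee_fin mulr_ge0// normal_pdf_ge0.
rewrite ge0_integral_normal_prob//; last exact: measurable_normal_prob_shift.
pose g (p : R * R) := (f p * (normal_pdf b t p.1)%:E)%E.
have mg : measurable_fun setT g.
  apply: emeasurable_funM => //; apply/measurable_EFinP.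
  exact: (measurableT_comp (measurable_normal_pdf b t)).
have g0 p : (0 <= g p)%E by rewrite mule_ge0// lee_fin normal_pdf_ge0.
transitivity (\int[leb]_x \int[leb]_y g (x, y))%E.
  apply: eq_integral => x _; rewrite normal_prob_shift// -ge0_integralZr//.
  - exact: measurable_normal_pdf_shift.
  - by move=> z _; exact: (f0 (x, z)).
  - by rewrite lee_fin normal_pdf_ge0.
rewrite (@fubini_tonelli _ _ _ _ _ leb leb g)//.
rewrite normal_probE; apply: eq_integral => z _.
set q := Num.sqrt _.
transitivity (\int[leb]_x ((normal_pdf (a + b) q z * \1_A z)%:E *
   (normal_pdf ((t ^+ 2 * (z - a) + s ^+ 2 * b) / (s ^+ 2 + t ^+ 2))
    (s * t / q) x)%:E))%E.
  apply: eq_integral => x _; rewrite /g /f/= -!EFinM; congr EFin.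
  by rewrite mulrAC normal_pdf_convE// mulrAC.
rewrite ge0_integralZl// ?integral_normal_pdf ?mule1//.
- by apply/measurable_EFinP; exact: measurable_normal_pdf.
- by move=> x _; rewrite lee_fin normal_pdf_ge0.
- by rewrite lee_fin mulr_ge0// normal_pdf_ge0.
Qed.

End NormalLaw.

(** * Independence combined with a prescribed law *)

Section IndepLaw.

Local Open Scope ereal_scope.
Context {R : realType} d (Omega : measurableType d) (P : probability Omega R).

(** One equation encodes two facts: [C = setT] says that [W] has law [nu], and then the general case
    is independence of [W] and [V]. A bare set function suffices for [nu]. *)
Definition indep_law d1 d2 (T1 : measurableType d1) (T2 : measurableType d2)
    (W : Omega -> T1) (V : Omega -> T2) (nu : set T1 -> \bar R) :=
  forall B C, measurable B -> measurable C ->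
    P (W @^-1` B `&` V @^-1` C) = nu B * P (V @^-1` C).

(** The joint law of [(W, V)] agrees with the product measure on rectangles, hence everywhere;
    Tonelli then integrates [W] out first. *)
Lemma indep_law_integral d1 d2 (T1 : measurableType d1)
    (T2 : measurableType d2) (W : Omega -> T1) (V : Omega -> T2)
    (nu : probability T1 R) (f : T1 * T2 -> \bar R) :
  measurable_fun setT W -> measurable_fun setT V -> indep_law W V nu ->
  measurable_fun setT f -> (forall p, 0 <= f p) ->
  \int[P]_w f (W w, V w) = \int[P]_w \int[nu]_x f (x, V w).
Proof.
move=> mW mV iWV mf f0.
pose V' : {mfun Omega >-> T2} := mfun_Sub (mem_set mV).
have mWV : measurable_fun setT (fun w => (W w, V w)) by exact: measurable_fun_pair.
pose WV : {mfun Omega >-> (T1 * T2)%type} := mfun_Sub (mem_set mWV).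
transitivity (\int[distribution P WV]_p f p).
  by rewrite ge0_integral_pushforward.
transitivity (\int[nu \x distribution P V']_p f p).
  apply: eq_measure_integral => //= A mA _; apply/esym.
  by apply: product_measure_unique => // B C mB mC; exact: iWV.
rewrite fubini_tonelli2// [LHS]ge0_integral_pushforward//.
  exact: measurable_fun_fubini_tonelli_G.
by move=> y _; exact: integral_ge0.
Qed.

(* [normal_prob] is a measure on [measurableTypeR R], whose display differs from
   that of [R]; the two structures have the same measurable sets. *)
Lemma indep_normal_integral d1 (T1 : measurableType d1) (W : Omega -> R)
    (V : Omega -> T1) (a s : R) (f : R * T1 -> \bar R) :
  measurable_fun setT W -> measurable_fun setT V ->
  indep_law W V (normal_prob a s) ->
  measurable_fun setT f -> (forall p, 0 <= f p) ->
  \int[P]_w f (W w, V w) = \int[P]_w \int[normal_prob a s]_x f (x, V w).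
Proof.
exact: (@indep_law_integral _ _ (measurableTypeR R) T1 W V (normal_prob a s) f).
Qed.

Lemma indep_law_comp d1 d2 d3 (T1 : measurableType d1)
    (T2 : measurableType d2) (T3 : measurableType d3)
    (W : Omega -> T1) (V : Omega -> T2) (q : T2 -> T3) nu :
  measurable_fun setT q -> indep_law W V nu -> indep_law W (q \o V) nu.
Proof.
move=> mq iWV B C mB mC; rewrite comp_preimage; apply: iWV => //.
by rewrite -[X in measurable X]setTI; exact: mq.
Qed.

(** Inductive step for normal sums: [V] contains the next summand [p V] and the remainder [q V].
    Integrating out [W] given [V], then [p V] given [q V], produces the convolution integral. *)
Lemma indep_law_normal_add d1 d2 (T1 : measurableType d1)
    (T2 : measurableType d2) (W : Omega -> R) (V : Omega -> T1)
    (p : T1 -> R) (q : T1 -> T2) (a b s t : R) :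
  (0 < s)%R -> (0 < t)%R -> measurable_fun setT W -> measurable_fun setT V ->
  measurable_fun setT p -> measurable_fun setT q ->
  indep_law W V (normal_prob a s) ->
  indep_law (p \o V) (q \o V) (normal_prob b t) ->
  indep_law (fun w => W w + p (V w))%R (q \o V)
    (normal_prob (a + b)%R (Num.sqrt (s ^+ 2 + t ^+ 2))).
Proof.
move=> s0 t0 mW mV mp mq iWV iX B C mB mC.
pose f (z : R * T1) := (\1_B (z.1 + p z.2) * \1_C (q z.2))%:E : \bar R.
have mf : measurable_fun setT f.
  apply/measurable_EFinP; apply: measurable_funM.
    apply: measurableT_comp => //; apply: measurable_funD => //.
    exact: measurableT_comp.
  by do 2 apply: measurableT_comp => //.
have f0 z : 0 <= f z by rewrite lee_fin mulr_ge0.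
(* What remains of [f] once [W] is integrated out; it depends on [V] only through [p V] and
   [q V]. *)
pose h (z : R * T2) :=
  normal_prob a s [set x | B (x + z.1)%R] * (\1_C z.2)%:E : \bar R.
have mh : measurable_fun setT h.
  apply: emeasurable_funM.
    exact: (measurableT_comp (measurable_normal_prob_shift a s mB)).
  by apply/measurable_EFinP; exact: measurableT_comp.
have h0 z : 0 <= h z by rewrite mule_ge0.
have mqV : measurable_fun setT (q \o V) by exact: measurableT_comp.
have mpV : measurable_fun setT (p \o V) by exact: measurableT_comp.
have mqVC : measurable ((q \o V) @^-1` C).
  by rewrite -[X in measurable X]setTI; exact: mqV.
transitivity (\int[P]_w f (W w, V w)).
  rewrite -[LHS]/(P (((fun w => W w + p (V w))%R @^-1` B) `&` (q \o V) @^-1` C)).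
  rewrite -[X in P X]setIT -integral_indic//; last first.
    apply: measurableI => //; rewrite -[X in measurable X]setTI.
    by apply: measurable_funD.
  by apply: eq_integral => w _; rewrite indicI.
rewrite (indep_normal_integral mW mV iWV mf f0).
transitivity (\int[P]_w h (p (V w), q (V w))).
  apply: eq_integral => w _; rewrite /f/h/=.
  under eq_integral do rewrite EFinM.
  have mBw : measurable [set x | B (x + p (V w))%R].
    have mD : measurable_fun setT (fun x : R => x + p (V w))%R.
      exact: measurable_funD.
    by rewrite -[X in measurable X]setTI; exact: mD.
  rewrite ge0_integralZr//.
  - by congr (_ * _); rewrite -[in RHS](setIT (mkset _)) -integral_indic.
  - by apply/measurable_EFinP; exact: (@measurable_indic _ (measurableTypeR R) R setT _ mBw).
rewrite (indep_normal_integral mpV mqV iX mh h0).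
transitivity (\int[P]_w (normal_prob (a + b)%R (Num.sqrt (s ^+ 2 + t ^+ 2)) B *
    (\1_C (q (V w)))%:E)).
  apply: eq_integral => w _; rewrite -(normal_prob_conv a b s0 t0 mB) /h/=.
  rewrite ge0_integralZr//.
  exact: measurable_normal_prob_shift.
rewrite ge0_integralZl//.
  by congr (_ * _); rewrite -[in RHS](setIT (_ @^-1` _)) -integral_indic.
by apply/measurable_EFinP; exact: measurableT_comp.
Qed.

End IndepLaw.

(** * Boxes as a generating pi-system for tuples *)

Section TupleBoxes.
Context {R : realType}.
Local Open Scope ereal_scope.

Lemma measurable_tupleE d (T : measurableType d) N :
  @measurable _ (N.-tuple T) =
  <<s [set A | exists2 B : 'I_N -> set T, (forall i, measurable (B i)) &
        A = [set u | forall i, B i (tnth u i)]] >>.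
Proof.
apply/seteqP; split.
- apply: smallest_sub; first exact: smallest_sigma_algebra.
  move=> A; rewrite -bigcup_seq => -[i _ [B mB <-]].
  apply: sub_sigma_algebra.
  (* A cylinder over coordinate [i] is a box whose other sides are full. *)
  exists (fun j => if j == i then B else setT) => [j|]; first by case: ifP.
  apply/seteqP; split => u /=.
    by move=> [_ Bu] j; case: eqP => // ->.
  by move=> /(_ i); rewrite eqxx.
- apply: smallest_sub; first exact: sigma_algebra_measurable.
  move=> _ [B mB ->].
  rewrite (_ : [set u | _] =
      \big[setI/setT]_(i < N) ((fun u : N.-tuple T => tnth u i) @^-1` B i)).
    apply: bigsetI_measurable => i _; rewrite -[X in measurable X]setTI.
    exact: measurable_tnth.
  rewrite -bigcap_seq; apply/seteqP; split => [u Bu i _|u Bu i]; first exact: Bu.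
  by apply: Bu; rewrite /= mem_index_enum.
Qed.

(** Boxes are closed under intersection and generate the sigma-algebra, so uniqueness of measures
    applies to the two pushforwards; finiteness lets the constant sequence [setT] serve as the
    exhaustion. *)
Lemma measure_tuple_unique d d' (Omega : measurableType d)
    (T : measurableType d') N (V : Omega -> N.-tuple T)
    (m m' : {measure set Omega -> \bar R}) :
  measurable_fun setT V -> m setT < +oo ->
  (forall B : 'I_N -> set T, (forall i, measurable (B i)) ->
     m [set w | forall i, B i (tnth (V w) i)] =
     m' [set w | forall i, B i (tnth (V w) i)]) ->
  forall A, measurable A -> m (V @^-1` A) = m' (V @^-1` A).
Proof.
move=> mV moo mm' A mA.
have /= := @measure_unique _ R _ _ (fun=> setT) (measurable_tupleE T N) _ _ _
  (pushforward m V) (pushforward m' V) _ _ A mA.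
apply.
- move=> _ _ [B mB ->] [C mC ->]; exists (fun i => B i `&` C i).
    by move=> i; exact: measurableI.
  apply/seteqP; split => [u [Bu Cu] i|u BCu]; first by split.
  by split => i; have [] := BCu i.
- move=> _; exists (fun=> setT) => //.
  by apply/seteqP; split.
- by rewrite bigcup_const//; exists 0%N.
- exact: mV.
- exact: mV.
- by move=> _ [B mB ->]; exact: mm'.
- by move=> _; rewrite /pushforward preimage_setT.
Qed.

(** For fixed [E] both sides are finite measures of the event on [V]: the restriction of [P] to [E],
    and [P] scaled by [P E]. It is enough to compare them on boxes. *)
Lemma indep_event_tuple d d' (Omega : measurableType d)
    (T : measurableType d') N (P : probability Omega R)
    (V : Omega -> N.-tuple T) (E : set Omega) :
  measurable_fun setT V -> measurable E ->
  (forall B : 'I_N -> set T, (forall i, measurable (B i)) ->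
     P ([set w | forall i, B i (tnth (V w) i)] `&` E) =
     P E * P [set w | forall i, B i (tnth (V w) i)]) ->
  forall A, measurable A -> P (V @^-1` A `&` E) = P E * P (V @^-1` A).
Proof.
move=> mV mE PE A mA.
have PE0 : (0 <= fine (P E))%R by rewrite fine_ge0.
have PEE : (fine (P E))%:E = P E by rewrite fineK// fin_num_measure.
transitivity (mscale (NngNum PE0) P (V @^-1` A)); last first.
  by rewrite /mscale/= PEE.
apply: (@measure_tuple_unique _ _ _ _ _ V (mrestr P mE)) => //.
  by rewrite /= /mrestr setTI -ge0_fin_numE// fin_num_measure.
by move=> B mB; rewrite /= /mrestr /mscale/= PEE PE.
Qed.

End TupleBoxes.

(** * Sums over part of an independent normal family *)

Section IndepFamily.
Context {R : realType} d (Omega : measurableType d) (P : probability Omega R).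
Context (I : finType) (X : I -> Omega -> R).
Hypothesis mX : forall i, measurable_fun setT (X i).
Hypothesis iX : (forall B : I -> set R, (forall i, measurable (B i)) ->
  P (\bigcap_(i in [set: I]) (X i @^-1` B i)) = \prod_i P (X i @^-1` B i))%E.

Definition data (w : Omega) : #|I|.-tuple R :=
  [tuple X (enum_val i) w | i < #|I|].

(* Erased entries are set to 0 instead of dropped, so that all subfamilies live
   in the same tuple type. *)
Definition erase (D : {pred I}) (u : #|I|.-tuple R) : #|I|.-tuple R :=
  [tuple if enum_val i \in D then 0 else tnth u i | i < #|I|].

Lemma measurable_data : measurable_fun setT data.
Proof.
apply/measurable_fun_tnthP => i; rewrite /comp /data.
by under eq_fun do rewrite tnth_mktuple; exact: mX.
Qed.

Lemma measurable_erase D : measurable_fun setT (erase D).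
Proof.
apply/measurable_fun_tnthP => i; rewrite /comp /erase.
under eq_fun do rewrite tnth_mktuple.
by case: (enum_val i \in D); [exact: measurable_cst|exact: measurable_tnth].
Qed.

Lemma erase_erase (D D' : {pred I}) u : {subset D <= D'} -> erase D' (erase D u) = erase D' u.
Proof.
move=> DD'; apply: eq_from_tnth => i; rewrite !tnth_mktuple.
by case: ifPn => // iD'; rewrite ifN//; apply: contra iD' => /DD'.
Qed.

Lemma measurable_preimage_rv i B : measurable B -> measurable (X i @^-1` B).
Proof. by move=> mB; rewrite -[X in measurable X]setTI; exact: mX. Qed.

(** Since entry [i] is erased, a box condition on the erased data does not constrain [X i], and the
    product formula for the family splits off its factor. *)
Lemma indep_law_erase i (D : {pred I}) : i \in D ->
  indep_law P (X i) (erase D \o data) (fun B => P (X i @^-1` B)).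
Proof.
move=> iD B A mB mA.
have mV : measurable_fun setT (erase D \o data).
  by apply: measurableT_comp; [exact: measurable_erase|exact: measurable_data].
rewrite setIC; apply: (indep_event_tuple mV) => //.
  exact: measurable_preimage_rv.
move=> C mC.
(* At an erased coordinate the condition reads the constant 0, so this set is the whole line or
   empty. *)
pose C' j := [set x : R | C (enum_rank j) (if j \in D then 0 else x)].
have mC' j : measurable (C' j).
  rewrite /C'; case: (j \in D); last exact: mC.
  have [C0|C0] := pselect (C (enum_rank j) 0).
    by rewrite (_ : [set _ | _] = setT)//; apply/seteqP; split.
  by rewrite (_ : [set _ | _] = set0)//; apply/seteqP; split.
pose B' j := (if j == i then B else setT) `&` C' j.
have mB' j : measurable (B' j) by apply: measurableI => //; case: ifP.
have VE : [set w | forall j, C j (tnth ((erase D \o data) w) j)] =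
    \bigcap_(j in [set: I]) (X j @^-1` C' j).
  apply/seteqP; split => w /= H j.
    by move=> _; have := H (enum_rank j); rewrite !tnth_mktuple enum_rankK.
  by have := H (enum_val j) Logic.I; rewrite /C'/= !tnth_mktuple enum_valK.
rewrite VE (_ : _ `&` _ = \bigcap_(j in [set: I]) (X j @^-1` B' j)); last first.
  apply/seteqP; split => w /=.
    by move=> [H Bw] j _; split; [case: eqP => // ->|exact: H].
  move=> H; split => [j _|]; first by have [] := H j Logic.I.
  by have [] := H i Logic.I; rewrite /B' eqxx.
rewrite !iX// (bigD1 i)//= [in RHS](bigD1 i)//= muleA; congr (_ * _)%E.
  rewrite /B' eqxx /C' iD.
  have [C0|C0] := pselect (C (enum_rank i) 0).
    rewrite (_ : [set _ | _] = setT) ?setIT ?preimage_setT ?probability_setT ?mule1//.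
    by apply/seteqP; split.
  rewrite (_ : [set _ | _] = set0) ?setI0 ?preimage_set0 ?measure0 ?mule0//.
  by apply/seteqP; split.
apply: eq_bigr => j ji; rewrite /B' (negbTE ji) setTI//.
Qed.

Lemma indep_event_data (E : set Omega) : measurable E ->
  (forall B : I -> set R, (forall i, measurable (B i)) ->
     P ((\bigcap_(i in [set: I]) (X i @^-1` B i)) `&` E) =
     P (\bigcap_(i in [set: I]) (X i @^-1` B i)) * P E)%E ->
  forall A, measurable A -> P (data @^-1` A `&` E) = (P E * P (data @^-1` A))%E.
Proof.
move=> mE iE A mA; apply: (indep_event_tuple measurable_data) => // B mB.
rewrite (_ : [set w | _] =
    \bigcap_(i in [set: I]) (X i @^-1` B (enum_rank i))); last first.
  apply/seteqP; split => w /= H i.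
    by move=> _; have := H (enum_rank i); rewrite tnth_mktuple enum_rankK.
  by have := H (enum_val i) Logic.I; rewrite /= tnth_mktuple enum_valK.
by rewrite iE// muleC.
Qed.

(** Induction on [ks]. Data with only the tail erased still contain [X j], because [uniq] keeps [j]
    out of the tail; [indep_law_normal_add] then moves [X j] from the data into the sum. *)
Lemma indep_law_normal_sum (m s : I -> R) (ks : seq I) :
  (forall i, 0 < s i) ->
  (forall i B, measurable B -> P (X i @^-1` B) = normal_prob (m i) (s i) B) ->
  ks != [::] -> uniq ks ->
  indep_law P (fun w => \sum_(i <- ks) X i w) (erase [in ks] \o data)
    (normal_prob (\sum_(i <- ks) m i) (Num.sqrt (\sum_(i <- ks) s i ^+ 2))).
Proof.
move=> s0 lawX; elim: ks => // j [|k ks] IH _ /andP[jks uks].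
  rewrite !big_seq1 sqrtr_sqr gtr0_norm//.
  under eq_fun do rewrite big_seq1.
  move=> B C mB mC; rewrite indep_law_erase ?lawX// inE eqxx//.
set l := k :: ks in IH jks uks *.
have {}IH := IH isT uks.
have sl0 : 0 < Num.sqrt (\sum_(i <- l) s i ^+ 2).
  rewrite sqrtr_gt0 /l big_cons ltr_pwDl ?exprn_gt0// sumr_ge0// => i _.
  exact: sqr_ge0.
pose p (u : #|I|.-tuple R) := tnth u (enum_rank j).
have mp : measurable_fun setT p by exact: measurable_tnth.
have mV : measurable_fun setT (erase [in l] \o data).
  by apply: measurableT_comp; [exact: measurable_erase|exact: measurable_data].
have mW : measurable_fun setT (fun w => \sum_(i <- l) X i w).
  exact: measurable_sum.
have pV w : p (erase [in l] (data w)) = X j w.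
  by rewrite /p !tnth_mktuple enum_rankK ifN.
have qV : erase [in j :: l] \o (erase [in l] \o data) = erase [in j :: l] \o data.
  apply/funext => w /=; apply: erase_erase => i.
  by rewrite !inE => ->; rewrite orbT.
have iXj : indep_law P (p \o (erase [in l] \o data))
    (erase [in j :: l] \o (erase [in l] \o data)) (normal_prob (m j) (s j)).
  rewrite qV (_ : p \o _ = X j); last exact/funext.
  by move=> B C mB mC; rewrite indep_law_erase ?lawX ?inE ?eqxx.
have := indep_law_normal_add sl0 (s0 j) mW mV mp (measurable_erase _) IH iXj.
rewrite qV sqr_sqrtr; last by apply: sumr_ge0 => i _; exact: sqr_ge0.
rewrite !(big_cons _ _ j) addrC [X in Num.sqrt X]addrC.
have -> // : (fun w => \sum_(i <- l) X i w + p ((erase [in l] \o data) w)) =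
  (fun w => \sum_(i <- j :: l) X i w).
by apply/funext => w; rewrite (big_cons _ _ j) -pV addrC.
Qed.

End IndepFamily.

(** * Likelihood ratios of normal variables beside an independent component *)

Section ChangeOfLaw.
Context {R : realType}.

Lemma normal_pdf_gt0 (m s x : R) : s != 0 -> 0 < normal_pdf m s x.
Proof. by move=> s0; rewrite normal_pdfE// mulr_gt0 ?expR_gt0 ?normal_peak_gt0. Qed.

Lemma normal_pdf_subr (m s c x : R) : s != 0 ->
  normal_pdf m s (x - c) = normal_pdf (m + c) s x.
Proof.
move=> s0; rewrite !normal_pdfE// /normal_fun.
by have -> : x - c - m = x - (m + c) by ring.
Qed.

(** The factor [c^-1] is the Jacobian; it depends on neither [m] nor [s], so it cancels in a
    likelihood ratio. *)
Lemma normal_pdf_affine (b c m s x : R) : 0 < c -> 0 < s ->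
  normal_pdf (b + c * m) (c * s) (b + c * x) = c^-1 * normal_pdf m s x.
Proof.
move=> c0 s0; have cs0 : 0 < c * s by rewrite mulr_gt0.
rewrite !normal_pdfE ?gt_eqF// mulrA; congr (_ * expR _).
  rewrite /normal_peak exprMn -mulrA -mulrnAr sqrtrM ?sqr_ge0// sqrtr_sqr.
  by rewrite gtr0_norm// invfM.
rewrite !mulNr; congr (- _).
have -> : b + c * x - (b + c * m) = c * (x - m) by ring.
by rewrite !exprMn -mulrnAr -mulf_div divff ?mul1r// gt_eqF// exprn_gt0.
Qed.

Context d (Omega : measurableType d) (P : probability Omega R).

Lemma indep_normal_change d1 d2 (T1 : measurableType d1)
    (T2 : measurableType d2) (W0 W1 : Omega -> R) (Z : Omega -> T1)
    (F : R * T1 -> T2) (m0 s0 m1 s1 z : R) (A : set T2) :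
  s0 != 0 -> s1 != 0 ->
  measurable_fun setT W0 -> measurable_fun setT W1 -> measurable_fun setT Z ->
  measurable_fun setT F ->
  indep_law P W0 Z (normal_prob m0 s0) -> indep_law P W1 Z (normal_prob m1 s1) ->
  measurable A ->
  P ((fun w => F (z + W1 w, Z w)) @^-1` A) =
  (\int[P]_(w in (fun w => F (W0 w, Z w)) @^-1` A)
    (normal_pdf (m1 + z) s1 (W0 w) / normal_pdf m0 s0 (W0 w))%:E)%E.
Proof.
move=> s00 s10 mW0 mW1 mZ mF i0 i1 mA.
have mF1 : measurable_fun setT (fun p : R * T1 => F (z + p.1, p.2)).
  apply: measurableT_comp => //; apply: measurable_fun_pair => //.
  exact: measurable_funD.
have mFA : measurable_fun setT (fun p : R * T1 => (\1_A (F p) : R)).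
  exact: (measurableT_comp (measurable_indic mA)).
pose f (p : R * T1) : \bar R := (\1_A (F (z + p.1, p.2)))%:E.
have mf : measurable_fun setT f.
  by apply/measurable_EFinP; apply: (measurableT_comp (measurable_indic mA)).
have f0 p : (0 <= f p)%E by rewrite lee_fin.
pose r (x : R) := normal_pdf (m1 + z) s1 x / normal_pdf m0 s0 x.
have mr : measurable_fun setT r.
  apply: measurable_funM; first exact: measurable_normal_pdf.
  (* The inverse density is an explicit exponential, which makes its measurability immediate. *)
  have -> : (fun x => (normal_pdf m0 s0 x)^-1) =
      (fun x => (normal_peak s0)^-1 * expR ((x - m0) ^+ 2 / (s0 ^+ 2 *+ 2))).
    apply/funext => x; rewrite normal_pdfE// /normal_fun invfM -expRN.
    by rewrite mulNr opprK.
  apply: measurable_funM => //; apply: measurableT_comp => //.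
  apply: measurable_funM => //; apply: measurable_funX.
  exact: measurable_funB.
have r0 x : 0 <= r x by rewrite divr_ge0 ?normal_pdf_ge0.
pose g (p : R * T1) : \bar R := (r p.1 * \1_A (F p))%:E.
have mg : measurable_fun setT g.
  by apply/measurable_EFinP; apply: measurable_funM => //; exact: measurableT_comp.
have g0 p : (0 <= g p)%E by rewrite lee_fin mulr_ge0.
transitivity (\int[P]_w f (W1 w, Z w))%E.
  rewrite -[in LHS](setIT (_ @^-1` _)) -integral_indic//.
  rewrite -[X in measurable X]setTI.
  exact: (measurableT_comp mF1 (measurable_fun_pair mW1 mZ)).
transitivity (\int[P]_w g (W0 w, Z w))%E; last first.
  rewrite [RHS]integral_mkcond; apply: eq_integral => w _.
  by rewrite epatch_indic /g EFinM.
rewrite (indep_normal_integral mW1 mZ i1 mf f0).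
rewrite (indep_normal_integral mW0 mZ i0 mg g0).
apply: eq_integral => w _.
have mgZ : measurable_fun setT (fun x : R => g (x, Z w)).
  exact: (measurableT_comp mg (pair2_measurable _)).
have mfZ : measurable_fun setT (fun x : R => f (x, Z w)).
  exact: (measurableT_comp mf (pair2_measurable _)).
rewrite (ge0_integral_normal_prob m1 s1 mfZ (fun x => f0 _)).
rewrite (ge0_integral_normal_prob m0 s0 mgZ (fun x => g0 _)).
have mh : measurable_fun setT
    (fun x : R => g (x, Z w) * (normal_pdf m0 s0 x)%:E)%E.
  apply: emeasurable_funM => //; apply/measurable_EFinP.
  exact: measurable_normal_pdf.
have h0 x : (0 <= g (x, Z w) * (normal_pdf m0 s0 x)%:E)%E.
  by rewrite mule_ge0// lee_fin normal_pdf_ge0.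
(* Translation by [z] aligns the arguments of [F]. The density [normal_pdf m0 s0] then cancels the
   denominator of [r], and its numerator at [x + z] is [normal_pdf m1 s1 x]. *)
rewrite -[RHS](ge0_integral_shift z mh h0).
apply: eq_integral => x _; rewrite /f /g /r/= -!EFinM; congr EFin.
rewrite mulrAC divfK; last by rewrite gt_eqF// normal_pdf_gt0.
by rewrite -normal_pdf_subr// addrK mulrC (addrC z).
Qed.

End ChangeOfLaw.

(** * Running means as a function of one row sum and the other rows *)

Section RunningMean.
Context {R : realType} (T n : nat).

(** Row [tau] enters only through its sum [p.1]; the entries of [p.2] in that row are never read, so
    they may be erased. *)
Definition mean_of_row (tau : 'I_T) (p : R * #|{: 'I_T * 'I_n}|.-tuple R) :
    T.-tuple R :=
  [tuple (\sum_(j < T | (j <= i)%N)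
      (if j == tau then p.1 else \sum_(k < n) tnth p.2 (enum_rank (j, k)))) /
    (n * i.+1)%:R | i < T].

Lemma measurable_mean_of_row tau : measurable_fun setT (mean_of_row tau).
Proof.
apply/measurable_fun_tnthP => i; rewrite /comp /mean_of_row.
under eq_fun do rewrite tnth_mktuple.
apply: measurable_funM => //.
under eq_fun do rewrite big_mkcond.
apply: measurable_sum => j; case: (j <= i)%N => //.
case: (j == tau); first exact: measurable_fst.
apply: measurable_sum => k.
exact: (measurableT_comp (measurable_tnth _)).
Qed.

Lemma muhat_mean_of_row (tau : 'I_T) (x : 'I_T -> 'I_n -> R) u :
  (forall t k, t != tau -> tnth u (enum_rank (t, k)) = x t k) ->
  muhat x = mean_of_row tau (\sum_(k < n) x tau k, u).
Proof.
move=> xu; apply: eq_from_tnth => i; rewrite !tnth_mktuple; congr (_ / _).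
apply: eq_bigr => j _; case: eqP => [->//|/eqP jt].
by apply: eq_bigr => k _; rewrite xu.
Qed.

Lemma muhat_prev0 (y : T.-tuple R) (tau : 'I_T) :
  tau = 0 :> nat -> muhat_prev y tau = 0.
Proof. by case: tau => -[]. Qed.

Lemma muhat_prevS (y : T.-tuple R) (tau i : 'I_T) :
  tau = i.+1 :> nat -> muhat_prev y tau = tnth y i.
Proof. by case: tau => -[|t] ht //= [ti]; congr tnth; exact: val_inj. Qed.

(** The sum over earlier rows is a multiple of the previous mean, so given that mean the current one
    is affine in the row sum. *)
Lemma mean_of_row_step (tau : 'I_T) p : (0 < n)%N ->
  tnth (mean_of_row tau p) tau =
  (tau.+1%:R - 1) / tau.+1%:R * muhat_prev (mean_of_row tau p) tau +
  (tau.+1%:R * n%:R)^-1 * p.1.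
Proof.
move=> n0; rewrite [LHS]tnth_mktuple.
have nR0 : n%:R != 0 :> R by rewrite pnatr_eq0 -lt0n.
rewrite (bigD1 tau)//= eqxx natrM mulrDl addrC (mulrC n%:R).
congr (_ + _); last by rewrite [RHS]mulrC.
(* At the first time the coefficient of the previous mean is 0 and there are no earlier rows. *)
have [t0|t0] := posnP tau.
  rewrite t0 subrr !mul0r big1 ?mul0r// => j /andP[+ jt].
  by rewrite leqn0 => /eqP j0; rewrite -val_eqE/= j0 t0 eqxx in jt.
have tT : (tau.-1 < T)%N by rewrite (leq_ltn_trans (leq_pred _)).
rewrite (@muhat_prevS _ _ (Ordinal tT)) ?prednK//= tnth_mktuple/= prednK//.
rewrite (eq_bigl (fun j : 'I_T => (j <= tau.-1)%N)); last first.
  by move=> j; rewrite -[RHS]ltnS prednK// ltn_neqAle andbC -val_eqE.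
have tR0 : tau%:R != 0 :> R by rewrite pnatr_eq0 -lt0n.
have tS0 : tau%:R + 1 != 0 :> R by rewrite natr1 pnatr_eq0.
by rewrite natrM -natr1; field; rewrite nR0 tR0 tS0.
Qed.

End RunningMean.

(** * The likelihood ratio of the running means *)

Unset Implicit Arguments. Set Strict Implicit. Set Printing Implicit Defensive.

Theorem theoremC1 (R : realType) (T n : nat) (hT : (1 <= T)%N) (hn : (2 <= n)%N)
  (tau : 'I_T) (zstar : R) (mu sigma : 'I_T -> R)
  (hsigma : forall t, 0 < sigma t)
  (d : measure_display) (Omega : measurableType d) (P : probability Omega R)
  (X : 'I_T -> 'I_n -> Omega -> R) (J : Omega -> 'I_n)
  (hXmeas : forall t k, measurable_fun setT (X t k))
  (hXlaw : forall t k (B : set R), measurable B ->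
     P (X t k @^-1` B) = normal_prob (mu t) (sigma t) B)
  (hJmeas : forall j, measurable (J @^-1` [set j]))
  (hJlaw : forall j, P (J @^-1` [set j]) = (n%:R^-1)%:E)
  (hindep : indep_data_J P X J) :
  let tau1 : R := (tau.+1)%:R in
  (* H0 data: X ; H1^tau data: X with X_(tau,J) replaced by zstar *)
  let Y : 'I_T -> 'I_n -> Omega -> R :=
    fun t k w => if (t == tau) && (k == J w) then zstar else X t k w in
  let m0 (y : T.-tuple R) : R :=
    (tau1 - 1) / tau1 * muhat_prev y tau + mu tau / tau1 in
  let v0 : R := sigma tau ^+ 2 / (tau1 ^+ 2 * n%:R) in
  let m1 (y : T.-tuple R) : R :=
    (tau1 - 1) / tau1 * muhat_prev y tau
    + ((n%:R - 1) * mu tau + zstar) / (tau1 * n%:R) in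
  let v1 : R := (n%:R - 1) * sigma tau ^+ 2 / (tau1 ^+ 2 * n%:R ^+ 2) in
  let LR (y : T.-tuple R) : R :=
    phi (m1 y) v1 (tnth y tau) / phi (m0 y) v0 (tnth y tau) in
  (* the law of (muhat_1,...,muhat_T) under H1^tau has density LR with
     respect to its law under H0 *)
  forall A : set (T.-tuple R), measurable A ->
    P ((fun w => muhat (fun t k => Y t k w)) @^-1` A)
    = (\int[P]_(w in (fun w => muhat (fun t k => X t k w)) @^-1` A)
         (LR (muhat (fun t k => X t k w)))%:E)%E.
Proof.
move=> tau1 Y m0 v0 m1 v1 LR A mA.
have n0 : (0 < n)%N by rewrite (leq_trans _ hn).
have nR0 : 0 < n%:R :> R by rewrite ltr0n.
have n1R : 0 < n%:R - 1 :> R by rewrite subr_gt0 ltr1n.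
have tau10 : 0 < tau1 by rewrite ltr0n.
pose I := ('I_T * 'I_n)%type.
pose Xp (i : I) := X i.1 i.2.
have mXp i : measurable_fun setT (Xp i) by exact: hXmeas.
have [indX indJ] := hindep.
have bigcapE (B : I -> set R) :
    \bigcap_(i in [set: I]) (Xp i @^-1` B i) =
    \bigcap_(i in [set: I]) (X i.1 i.2 @^-1` B (i.1, i.2)).
  by apply: eq_bigcapr => -[t k] _.
have iXp (B : I -> set R) : (forall i, measurable (B i)) ->
    (P (\bigcap_(i in [set: I]) (Xp i @^-1` B i)) =
     \prod_i P (Xp i @^-1` B i))%E.
  move=> mB; rewrite bigcapE (indX (fun t k => B (t, k)))//.
  by apply: eq_bigr => -[t k] _.
pose row : {pred I} := [pred i | i.1 == tau].
pose Z := erase row \o data Xp.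
have mZ : measurable_fun setT Z.
  by apply: measurableT_comp; [exact: measurable_erase|exact: measurable_data].
(* [K = predT] gives the row sum under H0; [K = predC1 j] gives the entries kept when entry [j] is
   replaced. *)
pose W (K : {pred 'I_n}) w := \sum_(k in K) X tau k w.
have mW K : measurable_fun setT (W K).
  rewrite /W; under eq_fun do rewrite -big_enum.
  by apply: measurable_sum => k; exact: hXmeas.
have lawW (K : {pred 'I_n}) : (0 < #|K|)%N -> indep_law P (W K) Z
    (normal_prob (#|K|%:R * mu tau) (Num.sqrt (#|K|%:R * sigma tau ^+ 2))).
  move=> K0; pose ks := [seq (tau, k) | k <- enum K].
  have ks0 : ks != [::] by rewrite -size_eq0 size_map -cardE -lt0n.
  have uks : uniq ks by rewrite map_inj_uniq ?enum_uniq// => k k' [].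
  have := indep_law_normal_sum mXp iXp (fun i => hsigma i.1)
    (fun i => @hXlaw i.1 i.2) ks0 uks.
  rewrite !big_map !big_enum /= !sumr_const !mulr_natl => H.
  (* Erasing all of row [tau], not just [K], makes the independent component [Z] the same for every
     [K]. *)
  have {H} := indep_law_comp (measurable_erase row) H.
  have -> : erase row \o (erase [in ks] \o data Xp) = Z.
    apply/funext => w /=; apply: erase_erase => i.
    by move=> /mapP[k _ ->]; exact: eqxx.
  congr (indep_law P _ Z _); apply/funext => w.
  by rewrite big_map big_enum.
have muX w : muhat (fun t k => X t k w) =
    mean_of_row tau (W predT w, Z w).
  apply: muhat_mean_of_row => t k tt.
  by rewrite !tnth_mktuple enum_rankK inE/= (negbTE tt).
have muY j w : muhat (fun t k => if (t == tau) && (k == j) then zstar else X t k w) =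
    mean_of_row tau (zstar + W (predC1 j) w, Z w).
  rewrite (@muhat_mean_of_row _ _ _ tau _ (Z w)); last first.
    by move=> t k tt; rewrite !tnth_mktuple enum_rankK inE/= (negbTE tt).
  congr (mean_of_row _ (_, _)); rewrite (bigD1 j)//= !eqxx; congr (_ + _).
  by apply: eq_bigr => k /negbTE ->; rewrite andbF.
pose s0 := Num.sqrt (n%:R * sigma tau ^+ 2).
pose s1 := Num.sqrt ((n%:R - 1) * sigma tau ^+ 2).
have s00 : 0 < s0 by rewrite sqrtr_gt0 mulr_gt0// exprn_gt0.
have s10 : 0 < s1 by rewrite sqrtr_gt0 mulr_gt0// exprn_gt0.
pose ratio x := normal_pdf ((n%:R - 1) * mu tau + zstar) s1 x /
  normal_pdf (n%:R * mu tau) s0 x.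
have LRE x u : LR (@mean_of_row R T n tau (x, u)) = ratio x.
  rewrite /LR /phi (mean_of_row_step tau (x, u) n0) -/tau1 /m1 /m0 [(x, u).1]/=.
  (* Both densities are images of the row sum densities under the map taking [x] to [b + c * x]. *)
  set b := _ * muhat_prev _ _; set c := (tau1 * n%:R)^-1.
  have c0 : 0 < c by rewrite invr_gt0 mulr_gt0.
  have -> : Num.sqrt v1 = c * s1.
    rewrite -[c in RHS]gtr0_norm// -sqrtr_sqr -sqrtrM ?sqr_ge0//.
    by congr Num.sqrt; rewrite /v1 /c; field; rewrite !gt_eqF.
  have -> : Num.sqrt v0 = c * s0.
    rewrite -[c in RHS]gtr0_norm// -sqrtr_sqr -sqrtrM ?sqr_ge0//.
    by congr Num.sqrt; rewrite /v0 /c; field; rewrite !gt_eqF.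
  have -> : mu tau / tau1 = c * (n%:R * mu tau).
    by rewrite /c; field; rewrite !gt_eqF.
  rewrite (mulrC _ c) !normal_pdf_affine//.
  by rewrite -mulf_div divff ?mul1r// invr_eq0 gt_eqF.
pose L := (\int[P]_(w in (fun w => mean_of_row tau (W predT w, Z w)) @^-1` A)
  (ratio (W predT w))%:E)%E.
(* The value [L] does not depend on [j], so averaging over [J] will leave it unchanged. *)
have replaced j :
    P ((fun w => mean_of_row tau (zstar + W (predC1 j) w, Z w)) @^-1` A) = L.
  have cn1 : #|predC1 j|%:R = n%:R - 1 :> R.
    by rewrite cardC1 card_ord -subn1 natrB.
  apply: indep_normal_change => //.
  - by rewrite gt_eqF.
  - by rewrite gt_eqF.
  - exact: measurable_mean_of_row.
  - have cn : #|(predT : {pred 'I_n})| = n := card_ord n.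
    by have := lawW predT; rewrite cn; exact.
  - have := lawW (predC1 j); rewrite cn1; apply.
    by rewrite cardC1 card_ord -subn1 subn_gt0.
under eq_integral do rewrite muX LRE.
rewrite (_ : (fun w => muhat (fun t k => X t k w)) =
    (fun w => mean_of_row tau (W predT w, Z w))); last exact/funext.
rewrite -/L.
(* The means with entry [j] replaced, as a function of the whole data tuple, so that independence of
   [J] from the data applies. *)
pose H j (u : #|{: I}|.-tuple R) := mean_of_row tau
  (zstar + \sum_(k in predC1 j) tnth u (enum_rank (tau, k)), erase row u).
have mH j : measurable_fun setT (H j).
  apply: measurableT_comp; first exact: measurable_mean_of_row.
  apply: measurable_fun_pair; last exact: measurable_erase.
  apply: measurable_funD => //.
  under eq_fun do rewrite -big_enum.
  by apply: measurable_sum => k; exact: measurable_tnth.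
have HE j w : H j (data Xp w) = mean_of_row tau (zstar + W (predC1 j) w, Z w).
  congr (mean_of_row _ (_ + _, _)); apply: eq_bigr => k _.
  by rewrite tnth_mktuple enum_rankK.
pose E j := data Xp @^-1` (H j @^-1` A) `&` J @^-1` [set j].
have mHA j : measurable (H j @^-1` A).
  by rewrite -[X in measurable X]setTI; exact: mH.
have mE j : measurable (E j).
  apply: measurableI => //; rewrite -[X in measurable X]setTI.
  exact: (measurable_data mXp).
(* The event is split by the value of [J]: the [n] pieces are disjoint, and each has probability
   [L / n]. *)
have -> : (fun w => muhat (fun t k => Y t k w)) @^-1` A =
    \big[setU/set0]_(j < n) E j.
  rewrite -bigcup_seq; apply/seteqP; split => w /=.
    move=> Aw; exists (J w); first by rewrite /= mem_index_enum.
    by split => //=; rewrite HE -muY.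
  by move=> [j _ [/= Aj Jw]]; rewrite HE -muY -Jw in Aj.
rewrite measure_bigsetU_ord//; last first.
  by move=> i j _ _ [w [[_ /= <-] [_ /= <-]]].
rewrite (eq_bigr (fun=> n%:R^-1%:E * L)%E) => [|j _].
  rewrite -ge0_sume_distrl => [|j _]; last by rewrite lee_fin invr_ge0 ltW.
  by rewrite sumEFin sumr_const card_ord -[n%:R^-1 *+ n]mulr_natl divff ?mul1e// gt_eqF.
have iJ (B : I -> set R) : (forall i, measurable (B i)) ->
    (P ((\bigcap_(i in [set: I]) (Xp i @^-1` B i)) `&` J @^-1` [set j]) =
     P (\bigcap_(i in [set: I]) (Xp i @^-1` B i)) * P (J @^-1` [set j]))%E.
  by move=> mB; rewrite bigcapE; exact: (indJ (fun t k => B (t, k))).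
transitivity (P (J @^-1` [set j]) * P (data Xp @^-1` (H j @^-1` A)))%E.
  exact: (indep_event_data mXp (hJmeas j) iJ (mHA j)).
rewrite hJlaw -(replaced j); congr (_ * P _)%E.
by apply/funext => w; rewrite /= HE.
Qed.
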